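(* Let $P$ be a bounded subset of a complete $\mathrm{CAT}(0)$ space $X$ and let $f:X\to X$ be an isometry that leaves $P$ invariant, i.e. $f(P)=P$. If $u:P\to\mathbb{R}$ is a bounded non-negative function, not identically $0$, such that $u(f(p))=u(p)$ for each $p\in P$, then the barycenter of $P$ relative to $u$ is a fixed point of $f$.
   Context: For $P\subseteq X$ bounded and $u:P\to\mathbb{R}$ bounded, non-negative and not identically $0$, the barycenter of $P$ relative to $u$ is the point $q_u\in X$ (which exists and is unique) such that $\sup\{u(p)d(q_u,p)\mid p\in P\}=\inf_{x\in X}\sup\{u(p)d(x,p)\mid p\in P\}$. *)

(* Defs.v *)
From HB Require Import structures.
From mathcomp Require Import all_boot all_order all_algebra.
From mathcomp Require Import all_classical all_reals topology normedtype.

Set Implicit Arguments.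
Unset Strict Implicit.
Unset Printing Implicit Defensive.

Import Order.TTheory GRing.Theory Num.Theory.
Import numFieldNormedType.Exports.

Local Open Scope classical_set_scope.
Local Open Scope ring_scope.

(* [completePseudoMetricType] carries a distinguished point, so these spaces
   are nonempty. *)
#[short(type="completeMetricType")]
HB.structure Definition CompleteMetric (R : numDomainType) :=
  {T of CompletePseudoMetric R T & Metric R T}.

(* The canonical norm of ['rV[R]_2] is the sup norm, hence these explicit
   definitions for the Euclidean plane. *)
Definition edist (R : realType) (a b : 'rV[R]_2) : R :=
  Num.sqrt (\sum_i (a 0 i - b 0 i) ^+ 2).

Definition esegment (R : realType) (a b : 'rV[R]_2) : set 'rV[R]_2 :=
  [set (1 - t) *: a + t *: b | t in `[0, 1]%classic].

Section CAT0.
Context {R : realType} {X : metricType R}.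

(* Only the restriction of [c] to [0, d(x, y)] is meaningful. *)
Definition geodesic_path (x y : X) (c : R -> X) : Prop :=
  [/\ c 0 = x, c (mdist x y) = y &
      {in `[0, mdist x y] &, forall s t, mdist (c s) (c t) = `|s - t|}].

Definition geodesic_segment (x y : X) (c : R -> X) : set X :=
  c @` `[0, mdist x y]%classic.

(* Vertices are indexed cyclically: side [i] runs from [v i] to
   [v (ordS i)]. *)
Definition geodesic_triangle (v : 'I_3 -> X) (c : 'I_3 -> R -> X) : Prop :=
  forall i, geodesic_path (v i) (v (ordS i)) (c i).

Definition comparison_triangle (v : 'I_3 -> X) (w : 'I_3 -> 'rV[R]_2) : Prop :=
  forall i j, edist (w i) (w j) = mdist (v i) (v j).

(* A point lying on several sides may have several comparison points. *)
Definition comparison_point (v : 'I_3 -> X) (c : 'I_3 -> R -> X)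
    (w : 'I_3 -> 'rV[R]_2) (x : X) (a : 'rV[R]_2) : Prop :=
  exists i, [/\ geodesic_segment (v i) (v (ordS i)) (c i) x,
                esegment (w i) (w (ordS i)) a &
                edist (w i) a = mdist (v i) x].

End CAT0.

Definition geodesic_space (R : realType) (X : metricType R) : Prop :=
  forall x y : X, exists c, geodesic_path x y c.

Definition CAT0 (R : realType) (X : metricType R) : Prop :=
  geodesic_space X /\
  forall (v : 'I_3 -> X) (c : 'I_3 -> R -> X) (w : 'I_3 -> 'rV[R]_2),
    geodesic_triangle v c -> comparison_triangle v w ->
    forall (x y : X) (a b : 'rV[R]_2),
      comparison_point v c w x a -> comparison_point v c w y b ->
      mdist x y <= edist a b.

Definition metric_bounded (R : realType) (X : metricType R) (P : set X) : Prop :=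
  exists (x : X) (r : R), P `<=` ball x r.

(* Surjectivity is not required. *)
Definition metric_isometry (R : realType) (X Y : metricType R) (f : X -> Y) : Prop :=
  forall x y, mdist (f x) (f y) = mdist x y.

(* In both definitions below only the values of [u] on [P] matter. The real
   [sup] is 0 on sets that are empty or not bounded above; this does not arise
   when [P] is nonempty and bounded and [u] is bounded on [P]. *)
Definition weighted_radius (R : realType) (X : metricType R) (P : set X)
    (u : X -> R) (x : X) : R :=
  sup [set u p * mdist x p | p in P].

Definition is_barycenter (R : realType) (X : metricType R) (P : set X)
    (u : X -> R) (q : X) : Prop :=
  weighted_radius P u q = inf (range (weighted_radius P u)).

(* Main.v *)
Require Import Defs.
From HB Require Import structures.
From mathcomp Require Import all_boot all_order all_algebra.
From mathcomp Require Import all_classical all_reals topology normedtype.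
From mathcomp Require Import ring lra.

(** The weighted radius of [P], the function
      [r x = sup {u p * d(x, p) | p in P}],
    is unchanged under [f], since [f] permutes the set of which the supremum is
    taken ([weighted_radius_isometry]). So [f] maps minimizers of [r] to
    minimizers, and the theorem follows once [r] is known to have exactly one
    minimizer.

    Existence and uniqueness both come from one property of [r]: points at
    which [r] is almost minimal are close to each other
    ([weighted_radius_well_posed]). As [r] is Lipschitz and the space is
    complete, the sublevel sets of [r] then form a Cauchy filter, whose limit
    is the unique minimizer ([well_posed_minimizer]).

    The property is where nonpositive curvature enters. Comparing the triangle
    [x, y, z] with a Euclidean one shows that the midpoint [m] of [x] and [y]
    satisfies the Bruhat-Tits inequality
      [d(m, z)^2 <= (d(x, z)^2 + d(y, z)^2) / 2 - d(x, y)^2 / 4]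
    for every [z] ([CAT0_midpoint]). If [x] and [y] are at distance at most [D]
    from all of [P], the gain [d(x, y)^2 / 4] is at least a fixed proportion
    [t = d(x, y)^2 / (4 D^2)] of [max (d(x, p), d(y, p))^2]. This turns the
    additive gain into a multiplicative one, which survives multiplication by
    weights [u p] that are arbitrarily small, and therefore passes to the
    supremum:
      [(r m)^2 <= (1 - t) * max (r x, r y)^2]
    ([weighted_radius_midpoint]). When [inf r > 0] and [x], [y] are almost
    minimal this forces [t], hence [d(x, y)], to be small. When [inf r = 0] the
    inequality says nothing, but then almost minimal points are close to any
    point of positive weight. *)

Set Implicit Arguments.

Import Order.TTheory GRing.Theory Num.Theory.
Import numFieldNormedType.Exports.

Local Open Scope classical_set_scope.
Local Open Scope ring_scope.

(** * The Euclidean plane *)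

(* The same name denotes an extended distance in the topology library. *)
Local Notation edist := Defs.edist.

Lemma sqr_edist (R : realType) (a b : 'rV[R]_2) :
  edist a b ^+ 2 = (a 0 0 - b 0 0) ^+ 2 + (a 0 1 - b 0 1) ^+ 2.
Proof.
rewrite /edist sqr_sqrtr; last by apply: sumr_ge0 => i _; exact: sqr_ge0.
rewrite !big_ord_recl big_ord0 addr0.
by rewrite (_ : lift ord0 ord0 = 1)//; exact/val_inj.
Qed.

Lemma edistC (R : realType) (a b : 'rV[R]_2) : edist a b = edist b a.
Proof. by congr Num.sqrt; apply: eq_bigr => i _; rewrite -sqrrN opprB. Qed.

Lemma edistxx (R : realType) (a : 'rV[R]_2) : edist a a = 0.
Proof.
by rewrite /edist big1 ?sqrtr0// => i _; rewrite subrr expr0n.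
Qed.

Lemma edist_eqP (R : realType) (a b : 'rV[R]_2) (r : R) : 0 <= r ->
  edist a b ^+ 2 = r ^+ 2 -> edist a b = r.
Proof.
by move=> r0 /eqP; rewrite eqrXn2 ?sqrtr_ge0// => /eqP.
Qed.

Lemma edist_midpointl (R : realType) (a b : 'rV[R]_2) :
  edist a ((1 - 2^-1) *: a + 2^-1 *: b) = edist a b / 2.
Proof.
apply: edist_eqP; first by rewrite divr_ge0// sqrtr_ge0.
by rewrite exprMn !sqr_edist !mxE; field.
Qed.

(** Apollonius's formula for the median: in the plane, the Bruhat-Tits
    inequality is an equality. *)
Lemma edist_apollonius (R : realType) (a b c : 'rV[R]_2) :
  edist ((1 - 2^-1) *: a + 2^-1 *: b) c ^+ 2 =
  (edist a c ^+ 2 + edist b c ^+ 2) / 2 - edist a b ^+ 2 / 4.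
Proof. by rewrite !sqr_edist !mxE; field. Qed.

(** Side lengths subject to the triangle inequalities are realised in the plane
    by the vertices [(0, 0)], [(a, 0)] and [(s, h)]. *)
Lemma triangle_apex (R : realType) (a b e : R) :
  0 <= a -> 0 <= b -> 0 <= e -> e <= a + b -> a <= b + e -> b <= a + e ->
  exists s h, s ^+ 2 + h ^+ 2 = b ^+ 2 /\ (s - a) ^+ 2 + h ^+ 2 = e ^+ 2.
Proof.
move=> a0 b0 e0 eab abe bae.
have [a_eq0|an0] := eqVneq a 0.
  by exists b, 0; rewrite (_ : e = b); [split; rewrite ?a_eq0; ring|lra].
(* Subtracting the two required equations leaves this value for [s]; the
   triangle inequalities then say that [s ^+ 2 <= b ^+ 2]. *)
have a_gt0 : 0 < a by rewrite lt_neqAle eq_sym an0.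
pose s := (a ^+ 2 + b ^+ 2 - e ^+ 2) / (2 * a).
have sa : 2 * a * s = a ^+ 2 + b ^+ 2 - e ^+ 2 by rewrite /s; field.
have sb : s <= b.
  rewrite -(ler_pM2l (x := 2 * a)) ?mulr_gt0// sa.
  have : 0 <= (e - (a - b)) * (e + (a - b)) by apply: mulr_ge0; lra.
  by nra.
have bs : - b <= s.
  rewrite -(ler_pM2l (x := 2 * a)) ?mulr_gt0// sa.
  have : 0 <= (a + b - e) * (a + b + e) by apply: mulr_ge0; lra.
  by nra.
have h0 : 0 <= b ^+ 2 - s ^+ 2.
  have : 0 <= (b - s) * (b + s) by apply: mulr_ge0; lra.
  by nra.
exists s, (Num.sqrt (b ^+ 2 - s ^+ 2)); rewrite sqr_sqrtr//; split; first ring.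
by rewrite sqrrB -mulr_natl; lra.
Qed.

(** * Midpoints in CAT(0) spaces *)

Lemma comparison_triangle_exists (R : realType) (X : metricType R)
  (v : 'I_3 -> X) : exists w, comparison_triangle v w.
Proof.
have [s [h [sb se]]] := @triangle_apex R (mdist (v 0) (v 1))
  (mdist (v 0) (v 2)) (mdist (v 1) (v 2)) (mdist_ge0 _ _) (mdist_ge0 _ _)
  (mdist_ge0 _ _)
  ltac:(by rewrite (metric_sym (v 0) (v 1)) metric_triangle)
  ltac:(by rewrite (metric_sym (v 1) (v 2)) metric_triangle)
  ltac:(by rewrite metric_triangle).
pose vec (x y : R) : 'rV[R]_2 := \row_j (if j == 0 then x else y).
have dvec x y x' y' r : 0 <= r -> (x - x') ^+ 2 + (y - y') ^+ 2 = r ^+ 2 ->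
    edist (vec x y) (vec x' y') = r.
  by move=> r0 E; apply: edist_eqP => //; rewrite sqr_edist !mxE.
pose w (i : 'I_3) := nth 0 [:: vec 0 0; vec (mdist (v 0) (v 1)) 0; vec s h] i.
have w01 : edist (w 0) (w 1) = mdist (v 0) (v 1).
  by apply: dvec; [exact: mdist_ge0|ring].
have w02 : edist (w 0) (w 2) = mdist (v 0) (v 2).
  by apply: dvec; [exact: mdist_ge0|rewrite -sb; ring].
have w12 : edist (w 1) (w 2) = mdist (v 1) (v 2).
  by apply: dvec; [exact: mdist_ge0|rewrite -se; ring].
have I3 (i : 'I_3) : [\/ i = 0, i = 1 | i = 2].
  by case: i => -[|[|[|//]]] ?; [constructor 1|constructor 2|constructor 3];
    exact/val_inj.
exists w => i j.
by case: (I3 i) (I3 j) => -> [] ->; rewrite ?edistxx ?mdistxx// edistC metric_sym.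
Qed.

(** The Bruhat-Tits (CN) inequality: [m] is the midpoint of a geodesic from [x]
    to [y], and the distance from [m] to [z] is compared with a median of a
    Euclidean triangle. The geodesic is chosen before [z], so that one [m]
    serves all [z]. *)
Lemma CAT0_midpoint (R : realType) (X : metricType R) (hX : CAT0 X) (x y : X) :
  exists m, forall z, mdist m z ^+ 2 <=
    (mdist x z ^+ 2 + mdist y z ^+ 2) / 2 - mdist x y ^+ 2 / 4.
Proof.
have [geo cat] := hX; have [c0 c0P] := geo x y.
have half01 : mdist x y / 2 \in `[0, mdist x y].
  by rewrite in_itv/=; have := mdist_ge0 x y => ?; apply/andP; split; lra.
exists (c0 (mdist x y / 2)) => z.
pose v (i : 'I_3) := nth z [:: x; y; z] i.
have [w wP] := comparison_triangle_exists X v.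
have /choice[c cP] : forall i, exists ci,
    geodesic_path (v i) (v (ordS i)) ci /\ (i = 0 -> ci = c0).
  move=> i; have [->|i0] := eqVneq i 0; first by exists c0.
  by have [ci ciP] := geo (v i) (v (ordS i)); exists ci; split => // /eqP;
    rewrite (negPf i0).
have tri : geodesic_triangle v c by move=> i; exact: (cP i).1.
have w01 : edist (w 0) (w 1) = mdist x y by rewrite wP.
have c00 : c 0 = c0 by exact: (cP 0).2.
have o0 : ordS (0 : 'I_3) = 1 by exact/val_inj.
have mP : comparison_point v c w (c0 (mdist x y / 2))
    ((1 - 2^-1) *: w 0 + 2^-1 *: w 1).
  exists 0; rewrite o0 c00; split.
  - by exists (mdist x y / 2).
  - by exists 2^-1 => //=; rewrite in_itv/=; lra.
  - rewrite edist_midpointl w01.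
    have [c0x _ iso] := c0P; rewrite -[v 0]/x -{2}c0x iso//.
      by rewrite sub0r normrN ger0_norm// divr_ge0// mdist_ge0.
    by rewrite in_itv/= lexx mdist_ge0.
(* The vertex [z] is seen as the origin of the side from [z] to [x]. *)
have zP : comparison_point v c w z (w 2).
  exists 2; split.
  - by exists 0; [rewrite /= in_itv/= lexx mdist_ge0|case: (tri 2)].
  - exists 0; first by rewrite /= in_itv/= lexx ler01.
    by rewrite subr0 scale1r scale0r addr0.
  - by rewrite edistxx mdistxx.
have := cat v c w tri wP _ _ _ _ mP zP.
rewrite -ler_sqr ?nnegrE ?mdist_ge0 ?sqrtr_ge0//.
by rewrite edist_apollonius !wP.
Qed.

(** * Well-posed minimization problems *)

(** Tykhonov well-posedness: if almost minimal points are close together, the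
    sublevel sets of [g] just above its infimum generate a Cauchy filter, and
    [g], being continuous, attains its infimum at the limit. *)
Lemma well_posed_minimizer (R : realType) (X : completeMetricType R)
    (g : X -> R) (L : R) (L_ge0 : 0 <= L)
    (g_lip : forall x y, g x <= g y + L * mdist x y)
    (g_lb : has_lbound (range g))
    (g_wp : forall delta, 0 < delta -> exists2 eps, 0 < eps &
      forall x y, g x <= inf (range g) + eps -> g y <= inf (range g) + eps ->
        mdist x y < delta) :
  exists q, unique (fun q => g q = inf (range g)) q.
Proof.
set I := inf (range g) in g_wp *.
have Ig x : I <= g x by apply: ge_inf => //; exists x.
have near_min e : 0 < e -> exists x, g x <= I + e.
  move=> e0; have hi : has_inf (range g) by split=> //; exists (g point), point.
  by have [_ [x _ <-] /ltW ?] := inf_adherent e0 hi; exists x.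
pose F := filter_from [set e : R | 0 < e] (fun e => [set x | g x <= I + e]).
have FF : ProperFilter F.
  apply: filter_from_proper; last by move=> e /= /near_min.
  apply: filter_from_filter; first by exists 1; rewrite /= ltr01.
  move=> i j /= i0 j0; exists (Num.min i j); first by rewrite /= lt_min i0.
  by move=> x /=; rewrite -lerBlDl le_min !lerBlDl => /andP.
have cF : cauchy F.
  apply: (@cauchy_exP R X F _) => eps /g_wp[e e0 close].
  have [x gx] := near_min _ e0; exists x, e => //= y gy.
  by rewrite ballEmdist; exact: close.
have Fq : F --> lim F by exact: cauchy_cvg.
set q := lim F in Fq.
have gq : g q = I.
  apply/eqP; rewrite eq_le Ig andbT; apply/ler_addgt0Pr => e e0.
  have d0 : 0 < e / (2 * (L + 1)) by rewrite divr_gt0// mulr_gt0// ltr_wpDl.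
  have e20 : 0 < e / 2 by rewrite divr_gt0.
  have Fball : F (ball q (e / (2 * (L + 1)))) by apply: Fq; exact: nbhsx_ballx.
  have Fsub : F [set x | g x <= I + e / 2] by exists (e / 2).
  have [x [/= qx gx]] := filter_ex (filterI Fball Fsub).
  rewrite ballEmdist/= in qx.
  apply: le_trans (g_lip q x) _.
  suff : L * mdist q x <= e / 2 by move: gx; lra.
  apply: (@le_trans _ _ ((L + 1) * (e / (2 * (L + 1))))).
    by apply: ler_pM => //; [exact: mdist_ge0|lra|exact: ltW].
  by rewrite le_eqVlt; apply/orP; left; apply/eqP; field; lra.
exists q; split => // x gx; apply/mdist_positivity/eqP.
rewrite eq_le mdist_ge0 andbT; apply/ler_addgt0Pr => e e0; rewrite add0r.
by have [d d0 close] := g_wp e e0; apply/ltW/close; rewrite ?gq ?gx lerDl ltW.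
Qed.

(** * The weighted radius *)

Section WeightedRadius.
Context (R : realType) (X : metricType R) (P : set X) (u : X -> R) (B : R).
Context (P_bounded : metric_bounded P).
Context (u_bounds : forall p, P p -> 0 <= u p <= B).
Context (p0 : X) (Pp0 : P p0) (up0 : 0 < u p0).

Let r := weighted_radius P u.

Lemma weighted_radius_ge x p : P p -> u p * mdist x p <= r x.
Proof.
move=> Pp; apply: ub_le_sup; last by exists p.
have [z [rho Pz]] := P_bounded.
exists (B * (mdist x z + rho)) => _ [p' Pp' <-].
have /andP[u0 uB] := u_bounds Pp'; apply: ler_pM => //; first exact: mdist_ge0.
apply: le_trans (metric_triangle _ z _) _.
by rewrite lerD2l; have := Pz _ Pp'; rewrite ballEmdist => /ltW.
Qed.

Lemma weighted_radius_le x c :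
  (forall p, P p -> u p * mdist x p <= c) -> r x <= c.
Proof.
move=> xc; apply: ge_sup; first by exists (u p0 * mdist x p0), p0.
by move=> _ [p Pp <-]; exact: xc.
Qed.

Lemma weighted_radius_ge0 x : 0 <= r x.
Proof.
apply: le_trans (weighted_radius_ge x Pp0).
by rewrite mulr_ge0// ?mdist_ge0// ltW.
Qed.

Lemma weighted_radius_lipschitz x y : r x <= r y + B * mdist x y.
Proof.
apply: weighted_radius_le => p Pp; have /andP[u0 uB] := u_bounds Pp.
apply: (@le_trans _ _ (u p * (mdist x y + mdist y p))).
  by rewrite ler_wpM2l// metric_triangle.
rewrite mulrDr addrC lerD ?weighted_radius_ge//.
by rewrite ler_wpM2r// mdist_ge0.
Qed.

(** A common multiplicative factor is needed here: the additive gain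
    [(u p) ^+ 2 * mdist x y ^+ 2 / 4] given by the Bruhat-Tits inequality at
    [p] may be arbitrarily small as [p] varies, and would be lost in the
    supremum. *)
Lemma weighted_radius_midpoint (hX : CAT0 X) x y (D A : R) : 0 < D ->
  (forall p, P p -> mdist x p <= D) -> (forall p, P p -> mdist y p <= D) ->
  r x <= A -> r y <= A ->
  exists m, r m ^+ 2 <= (1 - mdist x y ^+ 2 / (4 * D ^+ 2)) * A ^+ 2.
Proof.
move=> D0 xD yD xA yA; have [m mP] := CAT0_midpoint hX x y; exists m.
set d := mdist x y; set t := d ^+ 2 / (4 * D ^+ 2).
have d0 : 0 <= d by exact: mdist_ge0.
have D20 : 0 < D ^+ 2 by rewrite exprn_gt0.
have t0 : 0 <= t by rewrite divr_ge0 ?sqr_ge0// mulr_ge0// ltW.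
have tD : t * D ^+ 2 = d ^+ 2 / 4 by rewrite /t; field; rewrite lt0r_neq0.
(* [x] and [y] are both within [D] of [p0], which bounds their distance. *)
have t1 : t <= 1.
  rewrite -(ler_pM2r D20) tD mul1r.
  have : d <= 2 * D.
    apply: le_trans (metric_triangle x p0 y) _.
    by rewrite mulrDl mul1r lerD ?xD// metric_sym yD.
  move=> dD; have : d ^+ 2 <= (2 * D) ^+ 2.
    by rewrite lerXn2r ?nnegrE// mulr_ge0// ltW.
  by rewrite exprMn; lra.
have A0 : 0 <= A by exact: le_trans (weighted_radius_ge0 x) xA.
have B0 : 0 <= (1 - t) * A ^+ 2 by rewrite mulr_ge0 ?sqr_ge0// subr_ge0.
rewrite -(sqr_sqrtr B0) lerXn2r ?nnegrE ?sqrtr_ge0 ?weighted_radius_ge0//.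
apply: weighted_radius_le => p Pp; have /andP[u0 uB] := u_bounds Pp.
have um0 : 0 <= u p * mdist m p by rewrite mulr_ge0// mdist_ge0.
rewrite -(ler_pXn2r (n := 2)) ?nnegrE ?sqrtr_ge0// sqr_sqrtr//.
pose M := Num.max (mdist x p) (mdist y p).
have M0 : 0 <= M by rewrite le_max mdist_ge0.
have MD : M ^+ 2 <= D ^+ 2.
  by rewrite lerXn2r ?nnegrE// ?(ltW D0)// ge_max xD ?yD.
have uM : (u p * M) ^+ 2 <= A ^+ 2.
  rewrite lerXn2r ?nnegrE// ?mulr_ge0// maxr_pMr// ge_max.
  rewrite (le_trans (weighted_radius_ge x Pp))//.
  by rewrite (le_trans (weighted_radius_ge y Pp)).
apply: (@le_trans _ _ ((1 - t) * (u p * M) ^+ 2)); last first.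
  by rewrite ler_wpM2l// subr_ge0.
rewrite !exprMn [leRHS]mulrCA ler_wpM2l ?sqr_ge0//.
apply: le_trans (mP p) _; rewrite -/d -tD.
have xM : mdist x p ^+ 2 <= M ^+ 2.
  by rewrite lerXn2r ?nnegrE ?mdist_ge0// le_max lexx.
have yM : mdist y p ^+ 2 <= M ^+ 2.
  by rewrite lerXn2r ?nnegrE ?mdist_ge0// le_max lexx orbT.
(* The gain [t * D ^+ 2] dominates [t * M ^+ 2]. *)
have := ler_wpM2l t0 MD; lra.
Qed.

Lemma weighted_radius_lbound : has_lbound (range r).
Proof. by exists 0 => _ [x _ <-]; exact: weighted_radius_ge0. Qed.

(** A bound on the weighted radius of [x] bounds its distance to [p0], which has
    positive weight, hence to the bounded set [P]. *)
Lemma weighted_radius_sublevel_bounded c :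
  exists2 D, 0 < D & forall x, r x <= c -> forall p, P p -> mdist x p <= D.
Proof.
have [z [rho Pz]] := P_bounded.
have dz p : P p -> mdist z p < rho by move/Pz; rewrite ballEmdist.
have rho0 : 0 < rho by apply: le_lt_trans (mdist_ge0 _ _) (dz _ Pp0).
exists (`|c| / u p0 + 2 * rho).
  by rewrite ltr_wpDl ?mulr_gt0// divr_ge0// ltW.
move=> x xc p Pp.
apply: le_trans (metric_triangle x p0 p) _; apply: lerD.
  rewrite ler_pdivlMr// mulrC (le_trans (weighted_radius_ge x Pp0))//.
  by rewrite (le_trans xc)// ler_norm.
apply: le_trans (metric_triangle p0 z p) _.
by rewrite metric_sym; have := dz _ Pp; have := dz _ Pp0; lra.
Qed.

Lemma weighted_radius_well_posed (hX : CAT0 X) (delta : R) : 0 < delta ->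
  exists2 eps, 0 < eps & forall x y, r x <= inf (range r) + eps ->
    r y <= inf (range r) + eps -> mdist x y < delta.
Proof.
move=> delta0; set I := inf (range r).
have Ir x : I <= r x by apply: ge_inf; [exact: weighted_radius_lbound|exists x].
(* A null infimum forces near-minimizers to be near [p0]. *)
have : 0 <= I.
  apply: lb_le_inf => [|_ [x _ <-]]; first by exists (r p0), p0.
  exact: weighted_radius_ge0.
rewrite le_eqVlt => /predU1P[I0|I0].
  exists (delta * u p0 / 3); first by rewrite divr_gt0// mulr_gt0.
  move=> x y; rewrite -I0 !add0r => xe ye.
  have near0 x' : r x' <= delta * u p0 / 3 -> mdist x' p0 <= delta / 3.
    move=> /(le_trans (weighted_radius_ge x' Pp0)).
    by rewrite mulrC mulrAC ler_pM2r.
  apply: le_lt_trans (metric_triangle x p0 y) _.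
  by rewrite (metric_sym p0); have := near0 _ xe; have := near0 _ ye; lra.
(* The choice of [eps] below keeps [I + eps] under [2 * I], where [D] is valid,
   and makes [(1 - t) * (I + eps) ^+ 2 < I ^+ 2]. *)
have [D D0 rD] := weighted_radius_sublevel_bounded (I + I).
pose t := delta ^+ 2 / (4 * D ^+ 2).
have t0 : 0 < t by rewrite divr_gt0 ?mulr_gt0 ?exprn_gt0.
pose eps := Num.min I (t * I / 4).
have eps0 : 0 < eps by rewrite lt_min I0 divr_gt0// mulr_gt0.
have epsI : eps <= I by rewrite ge_min lexx.
have epst : eps <= t * I / 4 by rewrite ge_min lexx orbT.
exists eps => // x y xe ye; rewrite ltNge; apply/negP => dxy.
have le2I : I + eps <= I + I by rewrite lerD2l.
have [m] := weighted_radius_midpoint hX x y _ _ D0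
  (rD x (le_trans xe le2I)) (rD y (le_trans ye le2I)) xe ye.
apply/negP; rewrite -ltNge.
have Im : I ^+ 2 <= r m ^+ 2.
  by rewrite lerXn2r ?nnegrE ?Ir ?weighted_radius_ge0// ltW.
apply: lt_le_trans Im.
set t' := (X in 1 - X).
have tt' : t <= t'.
  rewrite ler_pM2r ?invr_gt0 ?mulr_gt0 ?exprn_gt0//.
  by rewrite lerXn2r ?nnegrE ?mdist_ge0// ltW.
have I20 : 0 < I ^+ 2 by rewrite exprn_gt0.
have A2 : (I + eps) ^+ 2 <= I ^+ 2 + 3 * (I * eps).
  by rewrite sqrrD; have := ler_wpM2r (ltW eps0) epsI; rewrite -!expr2; lra.
have IA : I ^+ 2 <= (I + eps) ^+ 2.
  by rewrite lerXn2r ?nnegrE ?addr_ge0 ?ltW// ltrDl.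
have tA : t * I ^+ 2 <= t' * (I + eps) ^+ 2.
  by rewrite ler_pM// ltW.
have Ie : I * eps <= t * I ^+ 2 / 4.
  rewrite (_ : t * I ^+ 2 / 4 = I * (t * I / 4)); last by field.
  by rewrite ler_wpM2l // ltW.
by have : 0 < t * I ^+ 2 by [rewrite mulr_gt0]; rewrite mulrBl mul1r; lra.
Qed.

End WeightedRadius.

(** Replacing [p] by [f p] reindexes the supremum at [f x] into that at [x]. *)
Lemma weighted_radius_isometry (R : realType) (X : metricType R) (P : set X)
    (u : X -> R) (f : X -> X) (hf : metric_isometry f) (hfP : f @` P = P)
    (huf : forall p, P p -> u (f p) = u p) (x : X) :
  weighted_radius P u (f x) = weighted_radius P u x.
Proof.
congr sup; apply/seteqP; split => _ [p Pp <-].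
  move: Pp; rewrite -{1}hfP => -[p' Pp' <-].
  by exists p' => //; rewrite hf huf.
by exists (f p); [rewrite -hfP; exists p|rewrite hf huf].
Qed.

(** * Fixed points of isometries *)

Theorem proposition5 (R : realType) (X : completeMetricType R) (hX : CAT0 X)
    (P : set X) (hP : metric_bounded P)
    (f : X -> X) (hf : metric_isometry f) (hfP : f @` P = P)
    (u : X -> R) (hub : [bounded u p | p in P])
    (hu0 : forall p, P p -> 0 <= u p) (hunz : exists2 p, P p & u p != 0)
    (huf : forall p, P p -> u (f p) = u p) :
  exists q : X, unique (is_barycenter P u) q /\ f q = q.
Proof.
have [p0 Pp0 up0] := hunz.
have up0_gt0 : 0 < u p0 by rewrite lt_neqAle eq_sym up0 hu0.
have [B B0 uB] := ex_strict_bound_gt0 hub.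
have u_bounds p : P p -> 0 <= u p <= B.
  by move=> Pp; rewrite hu0// (le_trans (ler_norm _))// ltW// uB.
have [q [q_min q_uniq]] : exists q, unique (is_barycenter P u) q.
  apply: (@well_posed_minimizer _ _ (weighted_radius P u) B (ltW B0)).
  - exact: (weighted_radius_lipschitz u _ hP u_bounds _ Pp0).
  - exact: (weighted_radius_lbound u _ hP u_bounds _ Pp0 up0_gt0).
  - exact: (weighted_radius_well_posed u _ hP u_bounds _ Pp0 up0_gt0 hX).
exists q; split => //; apply/esym/q_uniq.
by rewrite /is_barycenter weighted_radius_isometry.
Qed.
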